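(* Suppose that $\mathscr K_{\rm ms}\neq\varnothing$ and that there exists $\widetilde P=\widetilde P^\top\in\mathbb S^n$ with $G(\widetilde P)>0$ and $H(\widetilde P)>0$. Let $P^*$ be the unique stabilizing solution of the stochastic algebraic Riccati equation (SARE), and let $K^*=G(P^* )^{-1}L(P^* )$. Let $K^0\in\mathscr K_{\rm ms}$, and for $k=0,1,2,\ldots$ compute $P^k\in\mathbb S^n$ and $K^{k+1}$ from $$\mathcal L_{K^k}^*(P^k)+Q+(K^k)^\top RK^k=0,\qquad K^{k+1}=G(P^k)^{-1}L(P^k).$$ Then the following hold: 1. $P^k-P^*\ge 0$ and $G(P^k)\ge G(P^* )>0$ for all $k\ge 0$; consequently, $K^{k+1}$ is well defined. 2. $K^k\in\mathscr K_{\rm ms}$ for every $k\ge0$. 3. $P^*\le P^{k+1}\le P^k$ for all $k\ge0$. 4. $P^k\to P^*$ and $K^k\to K^*$ as $k\to\infty$.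
   Context: $\mathbb S^n$ is the space of real symmetric $n\times n$ matrices; for symmetric matrices, $>0$ ($\ge0$) means positive definite (positive semidefinite), and $X\ge Y$ means $X-Y\ge0$. The matrices $A\in\mathbb R^{n\times n}$, $B\in\mathbb R^{n\times m}$, $C\in\mathbb R^{n\times n}$, $D\in\mathbb R^{n\times m}$ are constant; they define the stochastic system $\mathrm dx=(Ax+Bu)\,\mathrm dt+(Cx+Du)\,\mathrm dw$ with scalar Wiener process $w$. The weights $Q\in\mathbb S^n$, $R\in\mathbb S^m$ are symmetric and may be indefinite. For $K\in\mathbb R^{m\times n}$ let $A_K=A-BK$, $C_K=C-DK$, and define linear operators on $\mathbb S^n$ by $$\mathcal L_K(Z)=A_KZ+ZA_K^\top+C_KZC_K^\top,\qquad \mathcal L_K^*(P)=A_K^\top P+PA_K+C_K^\top PC_K .$$ For a linear operator $\mathcal A$, $\sigma(\mathcal A)\subset\mathbb C$ is its spectrum (complex eigenvalues) and $s(\mathcal A)=\max_{\lambda\in\sigma(\mathcal A)}\operatorname{Re}\lambda$. The set of mean-square stabilizing gains is $\mathscr K_{\rm ms}=\{K\in\mathbb R^{m\times n}: s(\mathcal L_K)<0\}$. For $P\in\mathbb S^n$: $G(P)=R+D^\top PD$, $L(P)=B^\top P+D^\top PC$, and $$H(P)=\begin{bmatrix}A^\top P+PA+C^\top PC+Q & L(P)^\top\\ L(P)&G(P)\end{bmatrix}.$$ The SARE is $A^\top P+PA+C^\top PC+Q-L(P)^\top G(P)^{-1}L(P)=0$. A stabilizing solution of the SARE is a $P=P^\top$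 solving it with $G(P)>0$ and $G(P)^{-1}L(P)\in\mathscr K_{\rm ms}$. It is a known result (Rami and co-authors, 2001) that, under the two hypotheses in the first sentence of the claim, the SARE has a unique stabilizing solution $P^*$. *)

(* Defs.v *)
From HB Require Import structures.
From mathcomp Require Import all_boot all_order all_algebra.
From mathcomp Require Import all_classical all_reals all_analysis.
From mathcomp Require Import complex.

Set Implicit Arguments.
Unset Strict Implicit.
Unset Printing Implicit Defensive.

Import Order.TTheory GRing.Theory Num.Theory.
Import numFieldNormedType.Exports.

Local Open Scope classical_set_scope.
Local Open Scope ring_scope.

Definition symmetric_mx (R : realType) n (X : 'M[R]_n) : Prop := X^T = X.

Definition posdef_mx (R : realType) n (X : 'M[R]_n) : Prop :=
  symmetric_mx X /\
  forall v : 'cV[R]_n, v != 0 -> 0 < (v^T *m X *m v) ord0 ord0.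

Definition possemidef_mx (R : realType) n (X : 'M[R]_n) : Prop :=
  symmetric_mx X /\
  forall v : 'cV[R]_n, 0 <= (v^T *m X *m v) ord0 ord0.

Definition loewner_le (R : realType) n (X Y : 'M[R]_n) : Prop :=
  possemidef_mx (Y - X).

(* The complex-linear extension X + iY |-> f X + i f Y of a real-linear f. *)
Definition complexify (R : realType) n (f : 'M[R]_n -> 'M[R]_n)
    (Z : 'M[R[i]]_n) : 'M[R[i]]_n :=
  \matrix_(j, k) Complex (f (map_mx (@complex.Re R) Z) j k)
                         (f (map_mx (@complex.Im R) Z) j k).

(* Complex eigenvalues of f as an operator on the space of symmetric matrices
   (not on all square matrices): f is meant to be a real-linear map preserving
   symmetry, and eigenvectors are complex symmetric matrices. *)
Definition sym_spectrum (R : realType) n (f : 'M[R]_n -> 'M[R]_n) : set R[i] :=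
  [set l | exists Z : 'M[R[i]]_n,
     [/\ Z^T = Z, Z != 0 & complexify f Z = l *: Z]].

(* The spectrum of a linear operator is finite, and it is nonempty when n > 0;
   the supremum is then a maximum. For n = 0 the value is sup set0 = 0. *)
Definition spectral_abscissa (R : realType) n (f : 'M[R]_n -> 'M[R]_n) : R :=
  sup [set complex.Re l | l in sym_spectrum f].

Definition lyap_op (R : realType) n m (A : 'M[R]_n) (B : 'M[R]_(n, m))
    (C : 'M[R]_n) (D : 'M[R]_(n, m)) (K : 'M[R]_(m, n)) (Z : 'M[R]_n)
    : 'M[R]_n :=
  let AK := A - B *m K in
  let CK := C - D *m K in
  AK *m Z + Z *m AK^T + CK *m Z *m CK^T.

Definition lyap_op_adj (R : realType) n m (A : 'M[R]_n) (B : 'M[R]_(n, m))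
    (C : 'M[R]_n) (D : 'M[R]_(n, m)) (K : 'M[R]_(m, n)) (P : 'M[R]_n)
    : 'M[R]_n :=
  let AK := A - B *m K in
  let CK := C - D *m K in
  AK^T *m P + P *m AK + CK^T *m P *m CK.

Definition ms_stabilizing (R : realType) n m (A : 'M[R]_n) (B : 'M[R]_(n, m))
    (C : 'M[R]_n) (D : 'M[R]_(n, m)) : set 'M[R]_(m, n) :=
  [set K | spectral_abscissa (lyap_op A B C D K) < 0].

(* W is the (possibly indefinite) control weight. *)
Definition Gmx (R : realType) n m (D : 'M[R]_(n, m)) (W : 'M[R]_m)
    (P : 'M[R]_n) : 'M[R]_m :=
  W + D^T *m P *m D.

Definition Lmx (R : realType) n m (B : 'M[R]_(n, m)) (C : 'M[R]_n)
    (D : 'M[R]_(n, m)) (P : 'M[R]_n) : 'M[R]_(m, n) :=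
  B^T *m P + D^T *m P *m C.

Definition Hmx (R : realType) n m (A : 'M[R]_n) (B : 'M[R]_(n, m))
    (C : 'M[R]_n) (D : 'M[R]_(n, m)) (Q : 'M[R]_n) (W : 'M[R]_m)
    (P : 'M[R]_n) : 'M[R]_(n + m) :=
  block_mx (A^T *m P + P *m A + C^T *m P *m C + Q) (Lmx B C D P)^T
           (Lmx B C D P)                           (Gmx D W P).

(* G(P)^-1 L(P); meaningful only when G(P) is invertible, since invmx is the
   identity on singular matrices. *)
Definition gain (R : realType) n m (B : 'M[R]_(n, m)) (C : 'M[R]_n)
    (D : 'M[R]_(n, m)) (W : 'M[R]_m) (P : 'M[R]_n) : 'M[R]_(m, n) :=
  invmx (Gmx D W P) *m Lmx B C D P.

Definition solves_sare (R : realType) n m (A : 'M[R]_n) (B : 'M[R]_(n, m))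
    (C : 'M[R]_n) (D : 'M[R]_(n, m)) (Q : 'M[R]_n) (W : 'M[R]_m)
    (P : 'M[R]_n) : Prop :=
  A^T *m P + P *m A + C^T *m P *m C + Q
  - (Lmx B C D P)^T *m invmx (Gmx D W P) *m Lmx B C D P = 0.

Definition stabilizing_solution (R : realType) n m (A : 'M[R]_n)
    (B : 'M[R]_(n, m)) (C : 'M[R]_n) (D : 'M[R]_(n, m)) (Q : 'M[R]_n)
    (W : 'M[R]_m) (P : 'M[R]_n) : Prop :=
  [/\ symmetric_mx P, solves_sare A B C D Q W P, posdef_mx (Gmx D W P)
    & gain B C D W P \in ms_stabilizing A B C D].

Definition policy_iteration (R : realType) n m (A : 'M[R]_n)
    (B : 'M[R]_(n, m)) (C : 'M[R]_n) (D : 'M[R]_(n, m)) (Q : 'M[R]_n)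
    (W : 'M[R]_m) (K0 : 'M[R]_(m, n))
    (P : nat -> 'M[R]_n) (K : nat -> 'M[R]_(m, n)) : Prop :=
  K 0%N = K0 /\
  forall k : nat,
    [/\ symmetric_mx (P k),
        lyap_op_adj A B C D (K k) (P k) + Q + (K k)^T *m W *m K k = 0
      & K k.+1 = gain B C D W (P k)].

(* Main.v *)
From HB Require Import structures.
Require Import Defs.
From mathcomp Require Import all_boot all_order all_algebra.
From mathcomp Require Import all_classical all_reals all_analysis.
From mathcomp Require Import complex ring lra.
Import Order.TTheory GRing.Theory Num.Theory.
Import numFieldNormedType.Exports.
Local Open Scope classical_set_scope.
Local Open Scope ring_scope.

Set Implicit Arguments.
Unset Strict Implicit.
Unset Printing Implicit Defensive.

(* Spectral stability of L_K is equivalent to the existence of X > 0 with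
   L_K^*(X) < 0 (spectral_abscissa_lyap), and for such K, L_K^*(X) <= 0 forces
   X >= 0. Everything is then a comparison of the residuals
   L_K^*(P) + Q + K^T W K, which depend on K through a completed square.
   Since H(Pt) > 0, the residual of Pt is positive definite for every K, so
   P^k - Pt is positive definite, and it is also a strict Lyapunov certificate
   for K^{k+1}: no Perron-Frobenius or detectability argument is needed. The
   iterates decrease and are bounded below by P*; their limit solves the SARE,
   and comparing residuals at the stabilizing gain K* identifies it with P*. *)

(** * Quadratic forms and the Loewner order *)

Section QuadraticForms.
Variable R : realType.

Definition bform n (M : 'M[R]_n) (v w : 'cV[R]_n) : R :=
  (v^T *m M *m w) ord0 ord0.
Definition qform n (M : 'M[R]_n) (v : 'cV[R]_n) : R := bform M v v.

Lemma bformDl n (M N : 'M[R]_n) v w :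
  bform (M + N) v w = bform M v w + bform N v w.
Proof. by rewrite /bform mulmxDr mulmxDl mxE. Qed.

Lemma bformZl n a (M : 'M[R]_n) v w : bform (a *: M) v w = a * bform M v w.
Proof. by rewrite /bform -scalemxAr -scalemxAl mxE. Qed.

Lemma qformD n (M N : 'M[R]_n) v : qform (M + N) v = qform M v + qform N v.
Proof. exact: bformDl. Qed.

Lemma qformZ n a (M : 'M[R]_n) v : qform (a *: M) v = a * qform M v.
Proof. exact: bformZl. Qed.

Lemma qformN n (M : 'M[R]_n) v : qform (- M) v = - qform M v.
Proof. by rewrite -scaleN1r qformZ mulN1r. Qed.

Lemma qformB n (M N : 'M[R]_n) v : qform (M - N) v = qform M v - qform N v.
Proof. by rewrite qformD qformN. Qed.

Lemma qform0 n (M : 'M[R]_n) : qform M 0 = 0.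
Proof. by rewrite /qform /bform mulmx0 mxE. Qed.

Lemma qform_congr n m (M : 'M[R]_n) (T : 'M[R]_(n, m)) v :
  qform (T^T *m M *m T) v = qform M (T *m v).
Proof. by rewrite /qform /bform trmx_mul !mulmxA. Qed.

Lemma bform_lin n (M : 'M[R]_n) a u v w :
  bform M (a *: u + v) w = a * bform M u w + bform M v w.
Proof.
by rewrite /bform linearD linearZ /= !mulmxDl -!scalemxAl mxE; congr +%R; rewrite mxE.
Qed.

Lemma bformC n (M : 'M[R]_n) v w : symmetric_mx M -> bform M v w = bform M w v.
Proof.
move=> sM; rewrite /bform -[in LHS](trmxK (v^T *m M *m w)) mxE.
by rewrite !trmx_mul trmxK sM mulmxA.
Qed.

Lemma qform_comb n (M : 'M[R]_n) x y v w : symmetric_mx M ->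
  qform M (x *: v + y *: w)
  = x ^+ 2 * qform M v + 2 * x * y * bform M v w + y ^+ 2 * qform M w.
Proof.
move=> sM; have bZ a u t : bform M (a *: u) t = a * bform M u t.
  by rewrite -[a *: u]addr0 bform_lin /bform trmx0 !mul0mx [X in _ + X]mxE addr0.
rewrite /qform bform_lin (bZ y) (bformC v) // (bformC w) // !bform_lin !bZ.
by rewrite (bformC w v) //; ring.
Qed.

Lemma bform_delta n (M : 'M[R]_n) i v :
  bform M (delta_mx i ord0) v = (M *m v) i ord0.
Proof. by rewrite /bform trmx_delta -mulmxA -rowE mxE. Qed.

Lemma psd_cauchy_schwarz n (M : 'M[R]_n) v w : possemidef_mx M ->
  bform M v w ^+ 2 <= qform M v * qform M w.
Proof.
move=> [sM pM]; set a := qform M v; set b := bform M v w; set c := qform M w.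
have H x y : 0 <= x ^+ 2 * a + 2 * x * y * b + y ^+ 2 * c.
  by rewrite -qform_comb //; exact: pM.
have a0 : 0 <= a by exact: pM.
have c0 : 0 <= c by exact: pM.
have [a_gt0|] := ltrP 0 a.
  have := H (- b) a; have -> : (- b) ^+ 2 * a + 2 * (- b) * a * b + a ^+ 2 * c
    = a * (a * c - b ^+ 2) by ring.
  by rewrite pmulr_rge0 // subr_ge0.
move=> a_le0; have {a0 a_le0}a0 : a = 0 by apply/eqP; rewrite eq_le a_le0.
(* In the degenerate case [a = 0] these coefficients give [0 <= - (c + 2) * b ^+ 2], which forces
   [b = 0]. *)
have := H (- c - 1) b; rewrite a0 mul0r => H1.
have b2 : 0 <= b ^+ 2 by exact: sqr_ge0.
nra.
Qed.

Lemma psd_null n (M : 'M[R]_n) v : possemidef_mx M -> qform M v = 0 -> M *m v = 0.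
Proof.
move=> pM v0; apply/colP => i; rewrite [RHS]mxE -bform_delta.
have := psd_cauchy_schwarz (delta_mx i ord0) v pM; rewrite v0 mulr0 => h.
by apply/eqP; rewrite -sqrf_eq0 eq_le h sqr_ge0.
Qed.

Lemma posdef_psd n (M : 'M[R]_n) : posdef_mx M -> possemidef_mx M.
Proof.
move=> [sM pM]; split=> // v; have [->|/pM/ltW//] := eqVneq v 0.
by rewrite mulmx0 mxE.
Qed.

Lemma psd_posdef n (M : 'M[R]_n) : possemidef_mx M ->
  (forall v : 'cV[R]_n, M *m v = 0 -> v = 0) -> posdef_mx M.
Proof.
move=> pM kM; split=> [|v v0]; first exact: pM.1.
rewrite lt_def pM.2 andbT; apply: contra v0 => /eqP/(psd_null pM)/kM ->.
by rewrite eqxx.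
Qed.

Lemma posdef_inj n (M : 'M[R]_n) (v : 'cV[R]_n) : posdef_mx M -> M *m v = 0 -> v = 0.
Proof.
move=> [_ pM] v0; apply/eqP/negPn/negP => /pM.
by rewrite -mulmxA v0 mulmx0 mxE ltxx.
Qed.

Lemma posdef_unitmx n (M : 'M[R]_n) : posdef_mx M -> M \in unitmx.
Proof.
move=> pM; rewrite -row_free_unit -kermx_eq0; apply/rowV0P => u /sub_kermxP uM.
apply: trmx_inj; rewrite trmx0; apply: (posdef_inj pM).
by rewrite -[M in M *m _]pM.1 -trmx_mul uM trmx0.
Qed.

Lemma posdefD n (M N : 'M[R]_n) : posdef_mx M -> possemidef_mx N ->
  posdef_mx (M + N).
Proof.
move=> [sM pM] [sN pN]; split; first by rewrite /symmetric_mx linearD /= sM sN.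
move=> v v0; rewrite -/(bform _ _ _) -/(qform _ _) qformD.
by apply: ltr_pwDl; [exact: pM|exact: pN].
Qed.

Lemma psd0 n : possemidef_mx (0 : 'M[R]_n).
Proof. by split=> [|v]; [exact: trmx0|rewrite mulmx0 mul0mx mxE]. Qed.

Lemma psd_congr n m (M : 'M[R]_n) (T : 'M[R]_(n, m)) : possemidef_mx M ->
  possemidef_mx (T^T *m M *m T).
Proof.
move=> [sM pM]; split; first by rewrite /symmetric_mx !trmx_mul trmxK sM mulmxA.
by move=> v; rewrite -/(bform _ _ _) -/(qform _ _) qform_congr; exact: pM.
Qed.

Lemma posdef1 n : posdef_mx (1%:M : 'M[R]_n).
Proof.
split; first exact: trmx1.
move=> v v0; rewrite mulmx1 mxE.
have [i vi] : exists i, v i ord0 != 0 by apply/cV0Pn.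
rewrite (bigD1 i) //=; apply: ltr_pwDl.
  by rewrite mxE -expr2 exprn_even_gt0.
by apply: sumr_ge0 => j _; rewrite mxE -expr2 sqr_ge0.
Qed.

Lemma sym_qform_eq0 n (M : 'M[R]_n) : symmetric_mx M ->
  (forall v, qform M v = 0) -> M = 0.
Proof.
move=> sM qM; have pM : possemidef_mx M.
  by split=> // v; rewrite -/(bform _ _ _) -/(qform _ _) qM.
have Mv (v : 'cV[R]_n) : M *m v = 0 by apply: psd_null.
apply/matrixP => i j; have := Mv (delta_mx j ord0); rewrite -colE.
by move=> /colP/(_ i); rewrite !mxE.
Qed.

Lemma psd_antisym n (M N : 'M[R]_n) : loewner_le M N -> loewner_le N M -> M = N.
Proof.
move=> MN NM; apply/eqP; rewrite -subr_eq0; apply/eqP/sym_qform_eq0 => [|v].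
  exact: NM.1.
have qNM : 0 <= qform (N - M) v := MN.2 v.
have qMN : 0 <= qform (M - N) v := NM.2 v.
move: qNM qMN; rewrite !qformB !subr_ge0 => qMN qNM.
by apply/eqP; rewrite subr_eq0 eq_le qMN qNM.
Qed.

(* |v_i|^2 <= (X^-1)_ii qform X v by Cauchy-Schwarz in the form X, which makes
   any other form comparable with X without a compactness argument. *)
Lemma posdef_dominates n (X M : 'M[R]_n) : posdef_mx X ->
  exists2 c, 0 < c & forall v, `|qform M v| <= c * qform X v.
Proof.
move=> pX; have uX := posdef_unitmx pX.
pose Y := invmx X.
have sY : symmetric_mx Y by rewrite /symmetric_mx trmx_inv pX.1.
have coord (v : 'cV[R]_n) i : v i ord0 ^+ 2 <= `|Y i i| * qform X v.
  have := psd_cauchy_schwarz (Y *m delta_mx i ord0) v (posdef_psd pX).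
  rewrite {1}/bform trmx_mul sY -[_ *m Y *m X]mulmxA mulVmx // mulmx1.
  rewrite trmx_delta -rowE [X in X ^+ 2]mxE => /le_trans; apply.
  apply: ler_wpM2r; first exact: (posdef_psd pX).2.
  rewrite /qform {1}/bform trmx_mul sY trmx_delta -[_ *m Y *m X]mulmxA mulVmx //.
  by rewrite mulmx1 mulmxA -rowE -colE !mxE ler_norm.
pose c := \sum_i \sum_j `|M i j| * (`|Y i i| + `|Y j j|).
(* The added 1 keeps the constant strictly positive even when [M = 0]. *)
exists (1 + c).
  rewrite ltr_pwDl //; apply: sumr_ge0 => i _; apply: sumr_ge0 => j _.
  by rewrite mulr_ge0 // addr_ge0.
move=> v; have X0 : 0 <= qform X v by exact: (posdef_psd pX).2.
apply: (@le_trans _ _ (c * qform X v)); last by rewrite ler_wpM2r // lerDr.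
rewrite /qform {1}/bform mxE.
under eq_bigr do rewrite mxE big_distrl /=.
rewrite exchange_big /= /c big_distrl /=.
apply: (le_trans (ler_norm_sum _ _ _)); apply: ler_sum => i _.
rewrite big_distrl /=.
apply: (le_trans (ler_norm_sum _ _ _)); apply: ler_sum => j _.
rewrite mxE !normrM.
apply: (@le_trans _ _ (`|M i j| * (v i ord0 ^+ 2 + v j ord0 ^+ 2))); last first.
  by rewrite -mulrA ler_wpM2l // mulrDl lerD.
rewrite -[v i ord0 ^+ 2]real_normK ?num_real // -[v j ord0 ^+ 2]real_normK ?num_real //.
rewrite mulrAC [leLHS]mulrC ler_wpM2l //.
have := normr_ge0 (v i ord0); have := normr_ge0 (v j ord0).
have := sqr_ge0 (`|v i ord0| - `|v j ord0|).
set p := `|v i ord0|; set q := `|v j ord0|; nra.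
Qed.

(** If [c] bounds the form of [M] relative to [X], then [|t| <= (2 * c)^-1] costs at most half of
    the form of [X]. *)
Lemma posdef_perturb n (X M : 'M[R]_n) : posdef_mx X -> symmetric_mx M ->
  exists2 d, 0 < d & forall t, `|t| <= d -> posdef_mx (X + t *: M).
Proof.
move=> pX sM; have [c c0 dom] := posdef_dominates M pX.
exists (2 * c)^-1; first by rewrite invr_gt0 mulr_gt0.
move=> t td; split.
  by rewrite /symmetric_mx linearD linearZ /= sM pX.1.
move=> v v0; rewrite -/(bform _ _ _) -/(qform _ _) qformD qformZ.
have Xv : 0 < qform X v by exact: pX.2.
have : `|t * qform M v| <= 2^-1 * qform X v.
  rewrite normrM; apply: (@le_trans _ _ ((2 * c)^-1 * (c * qform X v))).
    by rewrite ler_pM.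
  by rewrite invfM -mulrA mulKf // gt_eqF.
by rewrite ler_norml => /andP[h _]; lra.
Qed.

End QuadraticForms.

(** * Lyapunov operators and their stability *)

Section LyapunovOperators.
Variables (F : comNzRingType) (n : nat).
Implicit Types A C P Z : 'M[F]_n.

(** [lyap_op A B C D K] unfolds to this at the closed-loop pair. The scalars are left general
    because eigenvectors live over [R[i]]. *)
Definition lyap A C Z := A *m Z + Z *m A^T + C *m Z *m C^T.
Definition lyap_adj A C P := A^T *m P + P *m A + C^T *m P *m C.

Lemma lyap_adjE A C P : lyap_adj A C P = lyap A^T C^T P.
Proof. by rewrite /lyap !trmxK. Qed.

Lemma lyap_lin A C a Z Y : lyap A C (a *: Z + Y) = a *: lyap A C Z + lyap A C Y.
Proof.
rewrite /lyap !(mulmxDr, mulmxDl) -!(scalemxAl, scalemxAr) !scalerDr.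
exact: etrans (congr1 (+%R^~ _) (addrACA _ _ _ _)) (addrACA _ _ _ _).
Qed.

HB.instance Definition _ A C :=
  GRing.isLinear.Build F 'M[F]_n 'M[F]_n *:%R (lyap A C) (@lyap_lin A C).

(** Its kernel is the space of symmetric matrices, which gives access to dimension counts and
    invariant subspaces. *)
Definition transpose_defect Z := Z^T - Z.

Lemma transpose_defect_linear : linear transpose_defect.
Proof.
by move=> a Z Y; rewrite /transpose_defect linearD linearZ /= scalerBr opprD addrACA.
Qed.

HB.instance Definition _ :=
  GRing.isLinear.Build F 'M[F]_n 'M[F]_n *:%R transpose_defect
    transpose_defect_linear.

Lemma lyap_adj_lin A C a P Y :
  lyap_adj A C (a *: P + Y) = a *: lyap_adj A C P + lyap_adj A C Y.
Proof. by rewrite !lyap_adjE lyap_lin. Qed.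

Lemma lyap_adjB A C P Y :
  lyap_adj A C (P - Y) = lyap_adj A C P - lyap_adj A C Y.
Proof. by rewrite addrC -scaleN1r lyap_adj_lin scaleN1r addrC. Qed.

(** Shifting [A] translates the spectrum of the operator, so an eigenvalue [l] becomes a kernel
    question for [A - (l / 2)%:M]. *)
Lemma lyap_shift A C t Z : lyap (A + t%:M) C Z = lyap A C Z + (2 * t) *: Z.
Proof.
rewrite /lyap linearD /= tr_scalar_mx mulmxDl mulmxDr mul_scalar_mx mul_mx_scalar.
rewrite mulr_natl mulr2n scalerDl -!addrA; congr +%R; rewrite addrCA; congr +%R.
by rewrite [RHS]addrC -addrA.
Qed.

Lemma lyap_adj_shift A C t P :
  lyap_adj (A + t%:M) C P = lyap_adj A C P + (2 * t) *: P.
Proof. by rewrite !lyap_adjE linearD /= tr_scalar_mx lyap_shift. Qed.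

Lemma lyap_shiftB A C t Z : lyap (A - t%:M) C Z = lyap A C Z - (2 * t) *: Z.
Proof. by rewrite -raddfN lyap_shift mulrN scaleNr. Qed.

Lemma lyap_adj_shiftB A C t P :
  lyap_adj (A - t%:M) C P = lyap_adj A C P - (2 * t) *: P.
Proof. by rewrite -raddfN lyap_adj_shift mulrN scaleNr. Qed.

Lemma lyap_tr A C Z : (lyap A C Z)^T = lyap A C Z^T.
Proof.
rewrite /lyap !linearD /= !trmx_mul !trmxK [X in X + _]addrC; congr +%R.
by rewrite mulmxA.
Qed.

Lemma lyap_adj_tr A C P : (lyap_adj A C P)^T = lyap_adj A C P^T.
Proof. by rewrite !lyap_adjE lyap_tr. Qed.

Lemma lyap_duality A C Z P :
  \tr (lyap A C Z *m P) = \tr (Z *m lyap_adj A C P).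
Proof.
rewrite /lyap /lyap_adj !mulmxDl !mulmxDr !linearD /=; congr (_ + _).
  rewrite addrC -!mulmxA; congr (_ + _).
  by rewrite mxtrace_mulC -!mulmxA.
by rewrite -!mulmxA [LHS]mxtrace_mulC -!mulmxA.
Qed.

End LyapunovOperators.

(** * Solvability of Lyapunov equations on symmetric matrices *)

Section Adjoint.
Variables (F : fieldType) (n : nat).
Hypothesis char_neq2 : 2 != 0 :> F.
Implicit Types A C P Z : 'M[F]_n.

(** Transposition commutes with [lyap A C], so it restricts to the finite-dimensional space [V] of
    symmetric matrices, where an injective endomorphism is onto. *)
Lemma lyap_inj_surj A C :
  (forall Z, Z^T = Z -> lyap A C Z = 0 -> Z = 0) ->
  forall M, M^T = M -> exists2 Z, Z^T = Z & lyap A C Z = M.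
Proof.
move=> injL M sM.
pose L := lyap A C; pose S := @transpose_defect F n.
pose V := lker (linfun S).
have memV Z : (Z \in V) = (Z^T == Z) by rewrite memv_ker lfunE /= subr_eq0.
have sub : (linfun L @: V <= V)%VS.
  apply/subvP => _ /memv_imgP[Z VZ ->]; move: VZ; rewrite !memV lfunE /= lyap_tr.
  by move=> /eqP ->.
have /eqP imV : (linfun L @: V == V)%VS.
  rewrite -(dimv_leqif_eq sub) limg_dim_eq //.
  apply/eqP; rewrite -subv0; apply/subvP => Z.
  by rewrite memv_cap memV memv_ker lfunE /= memv0 => /andP[/eqP sZ /eqP/injL->].
have : M \in (linfun L @: V)%VS by rewrite imV memV sM.
by move=> /memv_imgP[Z]; rewrite memV lfunE /= => /eqP sZ ->; exists Z.
Qed.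

(** By surjectivity of [lyap] and trace duality, [P] is orthogonal to every symmetric matrix.
    Testing on [delta_mx i j + delta_mx j i] gives [2 * P i j = 0], whence the condition on the
    characteristic. *)
Lemma lyap_adj_inj A C :
  (forall Z, Z^T = Z -> lyap A C Z = 0 -> Z = 0) ->
  forall P, P^T = P -> lyap_adj A C P = 0 -> P = 0.
Proof.
move=> injL P sP LP.
have trP M : M^T = M -> \tr (M *m P) = 0.
  move=> /(lyap_inj_surj injL)[Z _ <-].
  by rewrite lyap_duality LP mulmx0 mxtrace0.
apply/matrixP => i j; rewrite [RHS]mxE.
have := trP (delta_mx i j + delta_mx j i).
rewrite linearD /= !trmx_delta addrC => /(_ erefl).
have trd k l : \tr (delta_mx k l *m P) = P l k.
  rewrite -(mul_delta_mx (ord0 : 'I_1)) -mulmxA mxtrace_mulC -mulmxA.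
  by rewrite -colE -rowE /mxtrace big_ord1 !mxE.
have Pji : P j i = P i j by rewrite -[in LHS]sP mxE.
rewrite mulmxDl linearD /= !trd Pji => /eqP.
by rewrite -mulr2n -mulr_natl mulf_eq0 (negPf char_neq2) => /eqP.
Qed.

Lemma lyap_adj_inj_lyap A C :
  (forall P, P^T = P -> lyap_adj A C P = 0 -> P = 0) ->
  forall Z, Z^T = Z -> lyap A C Z = 0 -> Z = 0.
Proof.
move=> inj Z sZ LZ; apply: (@lyap_adj_inj A^T C^T) => //.
  by move=> P sP; rewrite -lyap_adjE; exact: inj.
by rewrite lyap_adjE !trmxK.
Qed.

Lemma lyap_adj_surj A C :
  (forall Z, Z^T = Z -> lyap A C Z = 0 -> Z = 0) ->
  forall M, M^T = M -> exists2 P, P^T = P & lyap_adj A C P = M.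
Proof.
move=> injL M sM; have [|P sP PM] := @lyap_inj_surj A^T C^T _ M sM.
  by move=> P sP; rewrite -lyap_adjE; exact: lyap_adj_inj.
by exists P => //; rewrite lyap_adjE.
Qed.

End Adjoint.

(** * Strict Lyapunov certificates, comparison and eigenvalues *)

Section LyapunovStability.
Variables (R : realType) (n : nat).
Implicit Types A C P X Y U V : 'M[R]_n.

(** The form of [X] is a quadratic Lyapunov function for dx = Ax dt + Cx dw. *)
Definition lyap_stable A C :=
  exists2 X, posdef_mx X & posdef_mx (- lyap_adj A C X).

Lemma qform_lyap_adj A C P v : symmetric_mx P ->
  qform (lyap_adj A C P) v = 2 * bform P v (A *m v) + qform P (C *m v).
Proof.
move=> sP; rewrite !qformD qform_congr mulrDl mul1r; congr (_ + _ + _).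
  by rewrite bformC // /qform /bform trmx_mul !mulmxA.
by rewrite /qform /bform !mulmxA.
Qed.

Lemma posdef_qform X v : posdef_mx X -> v != 0 -> 0 < qform X v.
Proof. by move=> [_]; apply. Qed.

Lemma psd_qform X v : possemidef_mx X -> 0 <= qform X v.
Proof. by move=> [_]; apply. Qed.

(* On the kernel of X the form of lyap_adj A C X is qform X (C v) >= 0. *)
Lemma psd_lyap_posdef A C X : possemidef_mx X ->
  posdef_mx (- lyap_adj A C X) -> posdef_mx X.
Proof.
move=> pX pL; apply: psd_posdef => // v Xv; apply/eqP/negPn/negP => v0.
have := posdef_qform pL v0; rewrite qformN (qform_lyap_adj _ _ _ pX.1).
rewrite (bformC _ _ pX.1) {1}/bform -mulmxA Xv mulmx0 mxE mulr0 add0r oppr_gt0.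
by rewrite ltNge psd_qform.
Qed.

(* Take the least s >= 0 with X + s X0 >= 0, where X0 witnesses stability: if
   s > 0 then X + s X0 is positive definite by psd_lyap_posdef and s could be
   decreased. *)
Lemma lyap_stable_psd A C X : lyap_stable A C -> symmetric_mx X ->
  possemidef_mx (- lyap_adj A C X) -> possemidef_mx X.
Proof.
move=> [X0 pX0 pL0] sX pL.
pose S := [set s | 0 <= s /\ forall v, 0 <= qform X v + s * qform X0 v].
have [c c0 dom] := posdef_dominates X pX0.
have Sc : S c.
  split=> [|v]; first exact: ltW.
  by have := dom v; rewrite ler_norml => /andP[]; rewrite -subr_ge0 opprK addrC.
have lb0 : lbound S 0 by move=> s [].
have s0_ge0 : 0 <= inf S by apply: lb_le_inf => //; exists c.
set s0 := inf S in s0_ge0.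
(* The infimum is attained: for each [v] the constraint is a lower bound on [s], and [inf S]
   respects every lower bound. *)
have S0 v : 0 <= qform X v + s0 * qform X0 v.
  have [->|v0] := eqVneq v 0; first by rewrite !qform0 mulr0 addr0.
  have Xv := posdef_qform pX0 v0.
  suff : - (qform X v) / qform X0 v <= s0.
    by rewrite ler_pdivrMr // => h; rewrite -[X in X + _]opprK addrC subr_ge0.
  apply: lb_le_inf; first by exists c.
  by move=> s [_ /(_ v)]; rewrite ler_pdivrMr // -[X in X + _]opprK addrC subr_ge0.
pose Y := X + s0 *: X0.
have sY : symmetric_mx Y by rewrite /symmetric_mx linearD linearZ /= sX pX0.1.
have pY : possemidef_mx Y.
  by split=> // v; rewrite -/(bform _ _ _) -/(qform _ _) qformD qformZ.
have [s0_gt0|s0_le0] := ltrP 0 s0; last first.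
  have s00 : s0 = 0 by apply/eqP; rewrite eq_le s0_le0.
  by move: pY; rewrite /Y s00 scale0r addr0.
have pLY : posdef_mx (- lyap_adj A C Y).
  rewrite /Y addrC lyap_adj_lin opprD addrC -scalerN addrC.
  apply: posdefD => //; split=> [|v v0].
    by rewrite /symmetric_mx linearZ /= pL0.1.
  rewrite -/(bform _ _ _) -/(qform _ _) qformZ.
  by rewrite mulr_gt0 // posdef_qform.
have {}pY := psd_lyap_posdef pY pLY.
have [d d0 pert] := posdef_perturb pY pX0.1.
pose e := Num.min d s0.
have e0 : 0 < e by rewrite lt_min d0.
have : s0 <= s0 - e; last by rewrite leNgt ltrBlDr ltrDl e0.
apply: ge_inf; first by exists 0.
split=> [|v]; first by rewrite subr_ge0 ge_min lexx orbT.
have : 0 <= qform (Y + (- e) *: X0) v.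
  by apply/psd_qform/posdef_psd/pert; rewrite normrN gtr0_norm // ge_min lexx.
by rewrite !qformD !qformZ -addrA -mulrDl.
Qed.

(** The same certificate [X] survives: the shift adds [(2 * t) *: X], which the strict inequality
    absorbs for small [t]. *)
Lemma lyap_stable_robust A C : lyap_stable A C ->
  exists2 d, 0 < d & forall t, `|t| <= d -> lyap_stable (A + t%:M) C.
Proof.
move=> [X pX pL]; have [d d0 pert] := posdef_perturb pL pX.1.
exists (d / 2) => [|t td]; first by rewrite divr_gt0.
exists X => //; rewrite lyap_adj_shift opprD -scaleNr; apply: pert.
by rewrite normrN normrM normr_nat mulrC -ler_pdivlMr.
Qed.

(* Decrease the shift t from a large value, where A - t is stable, down to 0:
   solvability of the shifted Lyapunov equation lets the process continue. *)
Lemma no_real_eigenvalue_lyap_stable A C :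
  (forall t Z, 0 <= t -> Z^T = Z -> lyap A C Z = t *: Z -> Z = 0) ->
  lyap_stable A C.
Proof.
move=> noev.
pose T := [set t | 0 <= t /\ lyap_stable (A - t%:M) C].
have s1 : symmetric_mx (1%:M : 'M[R]_n) by exact: trmx1.
have [c c0 dom] := posdef_dominates (lyap_adj A C 1%:M) (posdef1 R n).
have Tc : T c.
  split; first exact: ltW.
  exists 1%:M; first exact: posdef1.
  rewrite lyap_adj_shiftB opprB addrC.
  split=> [|v v0].
    by rewrite /symmetric_mx linearD linearN linearZ /= lyap_adj_tr s1.
  rewrite -/(bform _ _ _) -/(qform _ _) qformD qformN qformZ.
  have := dom v; rewrite ler_norml => /andP[_].
  have : 0 < qform 1%:M v by apply: posdef_qform => //; exact: posdef1.
  nra.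
have lbT : has_lbound T by exists 0 => t [].
have infT0 : 0 <= inf T by apply: lb_le_inf; [exists c|move=> t []].
have hasT : has_inf T by split; [exists c|].
set t0 := inf T in infT0.
(* A kernel element at shift [t0] would be an eigenvector for the excluded eigenvalue
   [2 * t0 >= 0]. *)
have [Y sY LY] : exists2 Y, Y^T = Y & lyap_adj (A - t0%:M) C Y = - 1%:M.
  apply: lyap_adj_surj; rewrite ?pnatr_eq0 //; last by rewrite linearN /= s1.
  move=> Z sZ; rewrite lyap_shiftB => /subr0_eq.
  by apply: noev => //; rewrite mulr_ge0.
have [d d0 pert] := posdef_perturb (posdef1 R n) sY.
have shift t : - lyap_adj (A - t%:M) C Y = 1%:M + (2 * (t - t0)) *: Y.
  have -> : A - t%:M = A - t0%:M + (t0 - t)%:M.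
    by rewrite raddfB addrA subrK.
  by rewrite lyap_adj_shift LY opprD opprK -scaleNr -mulrN opprB.
(* For [t] in [T] within [d / 2] of [t0], [Y] still satisfies the strict inequality at shift [t];
   stability there makes [Y] positive. *)
have pY : posdef_mx Y.
  have [t [t_ge0 tst] tt0] := inf_adherent (divr_gt0 d0 (ltr0Sn _ 1)) hasT.
  have t0t : t0 <= t by exact: (ge_inf lbT (conj t_ge0 tst)).
  have pL : posdef_mx (- lyap_adj (A - t%:M) C Y).
    rewrite shift; apply: pert.
    rewrite ger0_norm; last by rewrite mulr_ge0 // subr_ge0.
    by move: tt0; rewrite -/t0 => tt0; lra.
  by apply: (psd_lyap_posdef _ pL); apply: (lyap_stable_psd tst) => //; exact: posdef_psd.
have st0 : lyap_stable (A - t0%:M) C.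
  by exists Y => //; rewrite LY opprK; exact: posdef1.
have [t0_gt0|t0_le0] := ltrP 0 t0; last first.
  have t00 : t0 = 0 by apply/eqP; rewrite eq_le t0_le0.
  by move: st0; rewrite t00 raddf0 subr0.
have [r r0 rob] := lyap_stable_robust st0.
pose e := Num.min r t0.
have e0 : 0 < e by rewrite lt_min r0.
have : t0 <= t0 - e; last by rewrite leNgt ltrBlDr ltrDl e0.
apply: (ge_inf lbT); split; first by rewrite subr_ge0 ge_min lexx orbT.
rewrite raddfB opprB addrCA addrC; apply: rob.
by rewrite gtr0_norm // ge_min lexx.
Qed.

(* With T P = (1 + h A)^T P (1 + h A) + h C^T P C, the hypotheses say that T
   acts on span(U, V) as a rotation scaled by at least 1, up to O(h^2), while
   T X <= q X with q < 1: the norm of (U, V) relative to X must vanish. *)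
Lemma lyap_stable_eigen A C a b U V : lyap_stable A C -> 0 <= a ->
  symmetric_mx U -> symmetric_mx V ->
  lyap_adj A C U = a *: U - b *: V -> lyap_adj A C V = b *: U + a *: V ->
  U = 0 /\ V = 0.
Proof.
move=> [X pX pL] a0 sU sV LU LV.
have Xge0 v : 0 <= qform X v by exact/psd_qform/posdef_psd.
pose G x y v := x * qform U v + y * qform V v.
(* The infimum [c0] of [S] is the norm of the pair [(U, V)] relative to [X]. The aim is
   [c0 * q \in S] with [q < 1]. *)
pose S := [set c | 0 <= c /\ forall x y v, x ^+ 2 + y ^+ 2 = 1 ->
                   G x y v <= c * qform X v].
have [cU cU0 domU] := posdef_dominates U pX.
have [cV cV0 domV] := posdef_dominates V pX.
have Sc : S (cU + cV).
  split=> [|x y v xy1]; first by rewrite addr_ge0 // ltW.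
  have x1 : `|x| <= 1.
    by rewrite -(@ler_pXn2r _ 2) ?nnegrE // expr1n real_normK ?num_real // -xy1 lerDl sqr_ge0.
  have y1 : `|y| <= 1.
    by rewrite -(@ler_pXn2r _ 2) ?nnegrE // expr1n real_normK ?num_real // -xy1 lerDr sqr_ge0.
  rewrite mulrDl; apply: lerD; apply: (le_trans (ler_norm _)); rewrite normrM.
    by apply: le_trans (domU v); rewrite ler_piMl.
  by apply: le_trans (domV v); rewrite ler_piMl.
have c0_ge0 : 0 <= inf S by apply: lb_le_inf; [exists (cU + cV)|move=> c []].
have cle : lbound S (inf S) by move=> c Sc'; apply: ge_inf => //; exists 0 => s [].
set c0 := inf S in c0_ge0 cle.
have S0 x y v : x ^+ 2 + y ^+ 2 = 1 -> G x y v <= c0 * qform X v.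
  move=> xy1; have [->|v0] := eqVneq v 0; first by rewrite /G !qform0 !mulr0 addr0.
  have Xv := posdef_qform pX v0.
  rewrite -ler_pdivrMr //; apply: lb_le_inf; first by exists (cU + cV).
  by move=> s [_ /(_ x y v xy1)]; rewrite ler_pdivrMr.
have [e e0 LX] : exists2 e, 0 < e &
    forall v, e * qform X v <= - qform (lyap_adj A C X) v.
  have [c c_gt0 dom] := posdef_dominates X pL.
  exists c^-1; rewrite ?invr_gt0 // => v; rewrite ler_pdivrMl // -qformN.
  exact: le_trans (ler_norm _) (dom v).
have [k k0 XA] : exists2 k, 0 < k &
    forall v, qform X (A *m v) <= k * qform X v.
  have [c c_gt0 dom] := posdef_dominates (A^T *m X *m A) pX.
  exists c => // v; rewrite -qform_congr; exact: le_trans (ler_norm _) (dom v).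
pose h := e / (4 * k).
have h0 : 0 < h by rewrite divr_gt0 // mulr_gt0.
(* With [h = e / (4 * k)] the quadratic term is half of [h * e], leaving [1 - e ^+ 2 / (8 * k)]. The
   maximum with 0 keeps [c0 * q] nonnegative, as [S] requires. *)
pose q := Num.max 0 (1 - h * e + 2 * h ^+ 2 * k).
have q1 : q < 1.
  rewrite gt_max ltr01 /=.
  have -> : 1 - h * e + 2 * h ^+ 2 * k = 1 - e ^+ 2 / (8 * k).
    by rewrite /h; field; rewrite gt_eqF.
  by rewrite ltrBlDr ltrDl divr_gt0 ?exprn_gt0 ?mulr_gt0.
have q_ge0 : 0 <= q by rewrite le_max lexx.
pose x := 1 + h * a; pose y := h * b; pose r := Num.sqrt (x ^+ 2 + y ^+ 2).
have x1 : 1 <= x by rewrite lerDl mulr_ge0 // ltW.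
have r2 : r ^+ 2 = x ^+ 2 + y ^+ 2 by rewrite sqr_sqrtr // addr_ge0 // sqr_ge0.
have r_ge0 : 0 <= r by exact: sqrtr_ge0.
have r1 : 1 <= r by have := sqr_ge0 y; nra.
have r_gt0 : 0 < r by exact: lt_le_trans r1.
have Sq : S (c0 * q).
  split=> [|p s v ps1]; first by rewrite mulr_ge0.
  (* This rotates [p + i s] by the argument of [x + i y = 1 + h (a + i b)], cancelling the rotation
     that the eigenvalue equations produce; the modulus [r >= 1] remains, by [0 <= a]. *)
  pose p' := (x * p - y * s) / r; pose s' := (y * p + x * s) / r.
  have ps' : p' ^+ 2 + s' ^+ 2 = 1.
    have -> : p' ^+ 2 + s' ^+ 2 = (x ^+ 2 + y ^+ 2) * (p ^+ 2 + s ^+ 2) / r ^+ 2.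
      by rewrite /p' /s'; field; rewrite gt_eqF.
    by rewrite ps1 mulr1 -r2 divff // expf_neq0 // gt_eqF.
  have psN : (- p') ^+ 2 + (- s') ^+ 2 = 1 by rewrite !sqrrN.
  have rp : r * p = p' * x + s' * y.
    apply: (mulIf (lt0r_neq0 r_gt0)); rewrite -mulrA mulrC -mulrA -expr2 r2 /p' /s'.
    by field; rewrite gt_eqF.
  have rs : r * s = s' * x - p' * y.
    apply: (mulIf (lt0r_neq0 r_gt0)); rewrite -mulrA mulrC -mulrA -expr2 r2 /p' /s'.
    by field; rewrite gt_eqF.
  have step M w : symmetric_mx M -> qform M (w + h *: (A *m w)) =
      qform M w + h * (qform (lyap_adj A C M) w - qform M (C *m w))
      + h ^+ 2 * qform M (A *m w).
    move=> sM; rewrite -{1}[w]scale1r qform_comb // qform_lyap_adj //.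
    by rewrite expr1n; ring.
  (* The bound is used at three vectors: [H2] cancels the [C] terms left by expanding [H1], and
     [H3], with opposite signs, bounds the [h ^+ 2] terms. This is the source of the factor 2 in
     [q]. *)
  have H1 := S0 _ _ (v + h *: (A *m v)) ps'.
  have H2 := S0 _ _ (C *m v) ps'.
  have H3 := S0 _ _ (A *m v) psN.
  have H4 := LX v; have H5 := XA v; have H6 := Xge0 v.
  move: H1; rewrite /G !step ?pX.1 //; last exact: pX.1.
  rewrite LU LV qformB qformD !qformZ.
  set u := qform U v; set w := qform V v; set z := qform X v in H4 H5 H6 *.
  have -> : forall uC wC uA wA, p' * (u + h * (a * u - b * w - uC) + h ^+ 2 * uA) +
      s' * (w + h * (b * u + a * w - wC) + h ^+ 2 * wA) =
      (p' * x + s' * y) * u + (s' * x - p' * y) * w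
      - h * (p' * uC + s' * wC) - h ^+ 2 * (- p' * uA + - s' * wA).
    by move=> uC wC uA wA; rewrite /x /y; ring.
  rewrite -rp -rs => H1.
  have H2h := ler_wpM2l (ltW h0) H2.
  have H3h := ler_wpM2l (sqr_ge0 h) H3.
  have H4h := ler_wpM2l (mulr_ge0 c0_ge0 (ltW h0)) H4.
  have H5h := ler_wpM2l (mulr_ge0 c0_ge0 (sqr_ge0 h)) H5.
  have qle : c0 * ((1 - h * e + 2 * h ^+ 2 * k) * z) <= c0 * (q * z).
    by rewrite ler_wpM2l // ler_wpM2r // le_max lexx orbT.
  have rg : r * (p * u + s * w) <= c0 * (q * z) by rewrite /G in H2h H3h; lra.
  rewrite -mulrA; have [g0|g0] := lerP (p * u + s * w) 0.
    by apply: le_trans g0 _; rewrite !mulr_ge0.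
  by apply: le_trans rg; rewrite ler_peMl // ltW.
have c00 : c0 = 0.
  by have := cle _ Sq; nra.
have H0 v : qform U v = 0 /\ qform V v = 0.
  have H p s := S0 p s v; rewrite c00 /G mul0r in H.
  (* The four axis directions bound each of the two forms from both sides by 0. *)
  have := H 1 0; have := H (-1) 0; have := H 0 1; have := H 0 (-1).
  rewrite !sqrrN !expr1n !expr0n /= !addr0 !add0r.
  by move=> /(_ erefl) h1 /(_ erefl) h2 /(_ erefl) h3 /(_ erefl) h4; split; lra.
by split; apply: sym_qform_eq0 => // v; case: (H0 v).
Qed.

End LyapunovStability.

(** * Spectral characterization of stability *)

Section Complexification.
Variables (R : realType) (n : nat).
Implicit Types (A C U V : 'M[R]_n) (Z : 'M[R[i]]_n).

Definition complex_mx U V : 'M[R[i]]_n := \matrix_(j, k) Complex (U j k) (V j k).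

Local Notation cmx := (map_mx (real_complex R)).

Lemma complex_mxE U V : complex_mx U V = (Complex 0 1) *: (cmx V) + (cmx U).
Proof.
apply/matrixP => j k; rewrite !mxE; apply/eqP; rewrite eq_complex /=.
by apply/andP; split; apply/eqP; ring.
Qed.

Lemma complex_mx_ReIm Z :
  complex_mx (map_mx (@complex.Re R) Z) (map_mx (@complex.Im R) Z) = Z.
Proof. by apply/matrixP => j k; rewrite !mxE; case: (Z j k). Qed.

Lemma complex_mx_inj U V U' V' :
  complex_mx U V = complex_mx U' V' -> U = U' /\ V = V'.
Proof.
by move=> /matrixP E; split; apply/matrixP => j k; have := E j k; rewrite !mxE => -[].
Qed.

Lemma complex_mx0 : complex_mx 0 0 = 0.
Proof. by apply/matrixP => j k; rewrite !mxE. Qed.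

Lemma complex_mxZ a b U V :
  Complex a b *: complex_mx U V = complex_mx (a *: U - b *: V) (b *: U + a *: V).
Proof.
apply/matrixP => j k; rewrite !mxE; apply/eqP; rewrite eq_complex /=.
by rewrite eqxx /= addrC.
Qed.

Lemma complex_mx_tr U V : (complex_mx U V)^T = complex_mx U^T V^T.
Proof. by apply/matrixP => j k; rewrite !mxE. Qed.

Lemma lyap_real_complex A C U : lyap (cmx A) (cmx C) (cmx U) = cmx (lyap A C U).
Proof. by rewrite /lyap !map_trmx -!map_mxM -!map_mxD. Qed.

Lemma lyap_complex_mx A C U V :
  lyap (cmx A) (cmx C) (complex_mx U V) = complex_mx (lyap A C U) (lyap A C V).
Proof. by rewrite !complex_mxE lyap_lin !lyap_real_complex. Qed.

Lemma complexify_lyap A C Z : complexify (lyap A C) Z = lyap (cmx A) (cmx C) Z.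
Proof. by rewrite -[in RHS](complex_mx_ReIm Z) lyap_complex_mx. Qed.

(** [lyap_stable_eigen] concerns the adjoint, so the eigenvalue is first carried over to it: shifted
    by [l / 2], both operators are injective together. Real and imaginary parts then give the pair
    [(U, V)]. *)
Lemma lyap_stable_complex_eigen A C l Z : lyap_stable A C ->
  0 <= complex.Re l -> Z^T = Z -> lyap (cmx A) (cmx C) Z = l *: Z -> Z = 0.
Proof.
move=> st l0 sZ LZ.
have n2 : 2 != 0 :> R[i] by rewrite pnatr_eq0.
apply: (lyap_adj_inj_lyap n2 (A := (cmx A) - (l / 2)%:M) (C := (cmx C))) => //; last first.
  by rewrite lyap_shiftB mulrC divfK // LZ subrr.
move=> P sP; rewrite lyap_adj_shiftB mulrC divfK // => /subr0_eq.
move: sP; rewrite -(complex_mx_ReIm P); set U := map_mx _ P; set V := map_mx _ P.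
rewrite complex_mx_tr => /complex_mx_inj[sU sV].
rewrite lyap_adjE !map_trmx lyap_complex_mx -!lyap_adjE.
case: l l0 {LZ} => a b /= a0; rewrite complex_mxZ => /complex_mx_inj[LU LV].
have [-> ->] := lyap_stable_eigen st a0 sU sV LU LV.
by rewrite complex_mx0.
Qed.

(** The eigenvector must be symmetric, so algebraic closedness is applied to the restriction to the
    invariant subspace [V], which is nonzero because it contains the identity. *)
Lemma lyap_spectrum_neq0 A C : (0 < n)%N -> sym_spectrum (lyap A C) !=set0.
Proof.
move=> n_gt0.
pose L := lyap (cmx A) (cmx C); pose S := @transpose_defect R[i] n.
pose V := kermx (lin_mx S).
have memV (u : 'rV_(n * n)) : (u <= V)%MS = ((vec_mx u)^T == vec_mx u).
  by rewrite sub_kermx mul_rV_lin /= mxvec_eq0 subr_eq0.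
have stV : stablemx V (lin_mx L).
  apply/row_subP => j; rewrite row_mul memV mul_rV_lin /= mxvecK lyap_tr.
  by have := row_sub j V; rewrite memV => /eqP ->.
have rV : (0 < \rank V)%N.
  rewrite lt0n mxrank_eq0; apply/negP => /eqP V0.
  have : (mxvec (1%:M : 'M[R[i]]_n) <= V)%MS by rewrite memV mxvecK trmx1.
  rewrite V0 submx0 mxvec_eq0 => /eqP/matrixP/(_ (Ordinal n_gt0) (Ordinal n_gt0)).
  by rewrite !mxE eqxx => /eqP; rewrite oner_eq0.
have [l] := eigenvalue_closed (restrictmx V (lin_mx L)) rV.
move=> /eigenvalueP[u ul u0].
pose w := u *m row_base V.
have wL : w *m lin_mx L = l *: w.
  rewrite scalemxAl -ul /w /conjmx; set T := row_base V.
  have <- : u *m T *m lin_mx L *m pinvmx T *m T = u *m T *m lin_mx L.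
    by rewrite mulmxKpV // -mulmxA mulmx_sub // stablemx_row_base.
  by rewrite [u *m (T *m _ *m _)]mulmxA [u *m (T *m _)]mulmxA.
exists l, (vec_mx w); split.
- by apply/eqP; rewrite -memV mulmx_sub // eq_row_base.
- by rewrite vec_mx_eq0 mulmx_free_eq0 // row_base_free.
- by rewrite complexify_lyap -linearZ -wL mul_rV_lin /= mxvecK.
Qed.

Lemma spectral_abscissa_lyap A C : (0 < n)%N ->
  spectral_abscissa (lyap A C) < 0 <-> lyap_stable A C.
Proof.
move=> n_gt0; have [l0 l0P] := lyap_spectrum_neq0 A C n_gt0.
set E := [set complex.Re l | l in sym_spectrum (lyap A C)].
have E0 : E !=set0 by exists (complex.Re l0), l0.
split=> [sneg|st]; last first.
  (* Negative real parts alone would only give a supremum at most 0; robustness bounds all of them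
     by [- (2 * d)]. *)
  have [d d0 rob] := lyap_stable_robust st.
  have /rob{}st : `|d| <= d by rewrite gtr0_norm.
  apply: (@le_lt_trans _ _ (- (2 * d))); last by rewrite oppr_lt0 mulr_gt0.
  apply: ge_sup => // _ [l [Z [sZ Z0 LZ]] <-].
  rewrite leNgt; apply/negP => ld; move/eqP: Z0; apply.
  apply: (lyap_stable_complex_eigen (l := l + (real_complex R (2 * d))) st) => //.
    by move: ld; case: (l) => a b /= /ltW; rewrite -subr_ge0 opprK.
  rewrite map_mxD map_scalar_mx lyap_shift -complexify_lyap LZ scalerDl.
  by rewrite rmorphM rmorph_nat.
(* Without a supremum [sup E] would take its default value 0, against [sneg]. *)
have hE : has_sup E.
  by apply: contrapT => /sup_out E0'; move: sneg; rewrite /spectral_abscissa -/E E0' ltxx.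
apply: no_real_eigenvalue_lyap_stable => t Z t0 sZ LZ.
apply/eqP/negPn/negP => Z0.
have Et : E t.
  exists (Complex t 0) => //; exists (complex_mx Z 0); split.
  - by rewrite complex_mx_tr sZ trmx0.
  - by apply: contra Z0 => /eqP; rewrite -complex_mx0 => /complex_mx_inj[-> _].
  - rewrite complexify_lyap lyap_complex_mx complex_mxZ LZ !scale0r !scaler0 subr0 addr0.
    by congr complex_mx; rewrite /lyap !(mulmx0, mul0mx) !addr0.
have := sup_upper_bound hE Et; rewrite -/(spectral_abscissa _) leNgt.
by rewrite (lt_le_trans sneg t0).
Qed.
End Complexification.

(** * Entrywise convergence of matrices *)

Section EntrywiseConvergence.
Variable R : realType.

Definition mx_cvg m n (u : nat -> 'M[R]_(m, n)) (M : 'M[R]_(m, n)) : Prop :=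
  forall i j, u k i j @[k --> \oo] --> M i j.

Lemma mx_cvg_cvg m n (u : nat -> 'M[R]_(m, n)) M :
  mx_cvg u M -> u k @[k --> \oo] --> M.
Proof.
move=> uM; apply/cvg_mx_entourageP => E entE.
apply: filter_forall => i; apply: filter_forall => j.
have /cvg_app_entourageP/(_ E entE) := uM i j.
by apply: filterS => k /mem_set.
Qed.

Lemma mx_cvg_cst m n (M : 'M[R]_(m, n)) : mx_cvg (fun=> M) M.
Proof. by move=> i j; exact: cvg_cst. Qed.

Lemma eq_seq_cvg (f g : nat -> R) (l : R) : f =1 g ->
  g k @[k --> \oo] --> l -> f k @[k --> \oo] --> l.
Proof. by move=> /funext ->. Qed.

Lemma mx_cvgD m n (u v : nat -> 'M[R]_(m, n)) M N :
  mx_cvg u M -> mx_cvg v N -> mx_cvg (fun k => u k + v k) (M + N).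
Proof.
move=> uM vN i j; rewrite mxE.
apply: (@eq_seq_cvg _ (fun k => u k i j + v k i j)) => [k|]; first by rewrite mxE.
exact: cvgD (uM i j) (vN i j).
Qed.

Lemma mx_cvgN m n (u : nat -> 'M[R]_(m, n)) M :
  mx_cvg u M -> mx_cvg (fun k => - u k) (- M).
Proof.
move=> uM i j; rewrite mxE.
apply: (@eq_seq_cvg _ (fun k => - u k i j)) => [k|]; first by rewrite mxE.
exact: cvgN (uM i j).
Qed.

Lemma mx_cvg_tr m n (u : nat -> 'M[R]_(m, n)) M :
  mx_cvg u M -> mx_cvg (fun k => (u k)^T) M^T.
Proof.
move=> uM i j; rewrite mxE.
by apply: (@eq_seq_cvg _ (fun k => u k j i)) => [k|//]; rewrite mxE.
Qed.

Lemma mx_cvgM m n p (u : nat -> 'M[R]_(m, n)) (v : nat -> 'M[R]_(n, p)) M N :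
  mx_cvg u M -> mx_cvg v N -> mx_cvg (fun k => u k *m v k) (M *m N).
Proof.
move=> uM vN i j; rewrite mxE.
apply: (@eq_seq_cvg _ (fun k => \sum_l u k i l * v k l j)) => [k|].
  by rewrite mxE.
apply: cvg_big => [|l _]; first exact: add_continuous.
exact: cvgM (uM i l) (vN l j).
Qed.

Lemma cvg_det n (u : nat -> 'M[R]_n) M :
  mx_cvg u M -> \det (u k) @[k --> \oo] --> \det M.
Proof.
move=> uM; rewrite /determinant; apply: cvg_big => [|s _]; first exact: add_continuous.
apply: cvgM; first exact: cvg_cst.
by apply: cvg_big => [|i _]; [exact: mul_continuous|exact: uM].
Qed.

(** The cofactor formula reduces this to determinants; it describes [invmx] only at invertible
    matrices. *)
Lemma mx_cvgV n (u : nat -> 'M[R]_n) M :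
  (forall k, u k \in unitmx) -> M \in unitmx ->
  mx_cvg u M -> mx_cvg (fun k => invmx (u k)) (invmx M).
Proof.
move=> uu uM cu i j.
apply: (@eq_seq_cvg _ (fun k => (\det (u k))^-1 * cofactor (u k) j i)) => [k|].
  by rewrite /invmx uu !mxE.
rewrite /invmx uM !mxE; apply: cvgM.
  by apply: cvgV; [rewrite -unitfE -unitmxE|exact: cvg_det].
rewrite /cofactor; apply: cvgM; first exact: cvg_cst.
apply: cvg_det => a b; rewrite !mxE.
by apply: (@eq_seq_cvg _ (fun k => u k (lift j a) (lift i b))) => [k|//]; rewrite !mxE.
Qed.

Lemma mx_cvg_unique m n (u : nat -> 'M[R]_(m, n)) M N :
  mx_cvg u M -> mx_cvg u N -> M = N.
Proof.
by move=> uM uN; apply/matrixP => i j; apply: (cvg_unique _ (uM i j) (uN i j)).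
Qed.

Lemma mx_cvg_shiftS m n (u : nat -> 'M[R]_(m, n)) M :
  mx_cvg (fun k => u k.+1) M <-> mx_cvg u M.
Proof.
by split=> uM i j; have := uM i j; rewrite -(cvg_shiftS (fun k => u k i j)).
Qed.

Lemma mx_cvg_qform n (u : nat -> 'M[R]_n) M v :
  mx_cvg u M -> qform (u k) v @[k --> \oo] --> qform M v.
Proof.
by move=> uM; apply: mx_cvgM; [apply: mx_cvgM => //|]; exact: mx_cvg_cst.
Qed.

Lemma psd_closed n (u : nat -> 'M[R]_n) M :
  (forall k, possemidef_mx (u k)) -> mx_cvg u M -> possemidef_mx M.
Proof.
move=> pu uM; split.
  apply: (mx_cvg_unique (mx_cvg_tr uM)) => i j.
  by apply: (@eq_seq_cvg _ (fun k => u k i j)) => [k|//]; rewrite (pu k).1.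
move=> v; have qM := mx_cvg_qform (v := v) uM.
rewrite -/(bform _ _ _) -/(qform _ _) -(cvg_lim (@Rhausdorff R) qM).
apply: limr_ge; first by apply/cvg_ex; exists (qform M v).
by near=> k; exact: psd_qform.
Unshelve. all: by end_near. Qed.

(** Each quadratic form is a monotone bounded real sequence, and polarization ([uE]) recovers the
    entries. *)
Lemma mx_nonincreasing_cvg n (u : nat -> 'M[R]_n) M :
  (forall k, loewner_le M (u k)) -> (forall k, loewner_le (u k.+1) (u k)) ->
  (forall k, symmetric_mx (u k)) -> exists N, mx_cvg u N.
Proof.
move=> Mu uS su.
have cq v : cvgn (fun k => qform (u k) v).
  apply: nonincreasing_is_cvgn.
    by apply/nonincreasing_seqP => k; rewrite -subr_ge0 -qformB; exact: (uS k).2.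
  exists (qform M v) => _ [k _ <-].
  by rewrite -subr_ge0 -qformB; exact: (Mu k).2.
pose e i : 'cV[R]_n := delta_mx i ord0.
have uE k i j : u k i j =
    2^-1 * (qform (u k) (e i + e j) - qform (u k) (e i) - qform (u k) (e j)).
  rewrite -[e i]scale1r -[e j]scale1r qform_comb // !scale1r.
  by rewrite bform_delta -colE mxE; field.
exists (\matrix_(i, j) (2^-1 * (limn (fun k => qform (u k) (e i + e j))
   - limn (fun k => qform (u k) (e i)) - limn (fun k => qform (u k) (e j))))).
move=> i j; rewrite mxE; apply: (eq_seq_cvg (fun k => uE k i j)).
by apply: cvgM; [exact: cvg_cst|apply: cvgB; [apply: cvgB|]; exact: cq].
Qed.

End EntrywiseConvergence.

(** * Policy iteration *)

Section PolicyIteration.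
Variables (R : realType) (n m : nat).
Variables (A : 'M[R]_n) (B : 'M[R]_(n, m)) (C : 'M[R]_n) (D : 'M[R]_(n, m)).
Variables (Q : 'M[R]_n) (W : 'M[R]_m).
Hypothesis sW : symmetric_mx W.
Implicit Types (K : 'M[R]_(m, n)) (P : 'M[R]_n).

Local Notation L_adj := (lyap_op_adj A B C D).
Local Notation G := (Gmx D W).
Local Notation L := (Lmx B C D).
Local Notation stable K := (lyap_stable (A - B *m K) (C - D *m K)).

(** Policy evaluation at [K] is [residual K P = 0]. *)
Definition residual K P := L_adj K P + Q + K^T *m W *m K.

Lemma residualB K P P' : 
  residual K P - residual K P' = lyap_adj (A - B *m K) (C - D *m K) (P - P').
Proof.
rewrite lyap_adjB /residual -[L_adj K P + _ + _]addrA.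
by rewrite -[L_adj K P' + _ + _]addrA opprD addrACA subrr addr0.
Qed.

Lemma Gmx_sym P : symmetric_mx P -> symmetric_mx (G P).
Proof.
by move=> sP; rewrite /symmetric_mx linearD /= !trmx_mul trmxK sP sW mulmxA.
Qed.

Lemma GmxB P P' : G P - G P' = D^T *m (P - P') *m D.
Proof. by rewrite mulmxBr mulmxBl /Gmx opprD addrACA subrr add0r. Qed.

Lemma residual_expand K P : symmetric_mx P ->
  residual K P = A^T *m P + P *m A + C^T *m P *m C + Q
    - (L P)^T *m K - K^T *m L P + K^T *m G P *m K.
Proof.
move=> sP; rewrite /residual /lyap_op_adj /Lmx /Gmx.
rewrite !linearD !linearN /= !trmx_mul !trmxK sP.
rewrite !(mulmxDr, mulmxDl, mulmxN, mulNmx, mulmxA).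
by apply/matrixP => i j; rewrite !mxE; ring.
Qed.

(* Completing the square in K. *)
Lemma residual_gain K K' P : symmetric_mx P -> G P *m K' = L P ->
  residual K P = residual K' P + (K - K')^T *m G P *m (K - K').
Proof.
move=> sP GK; rewrite !residual_expand // -GK !trmx_mul (Gmx_sym sP).
rewrite [(K - K')^T]linearB /=.
rewrite !(mulmxDr, mulmxDl, mulmxN, mulNmx, mulmxA).
by apply/matrixP => i j; rewrite !mxE; ring.
Qed.

Lemma Hmx_residual K P :
  (col_mx 1%:M (- K))^T *m Hmx A B C D Q W P *m col_mx 1%:M (- K)
  = A^T *m P + P *m A + C^T *m P *m C + Q
    - (L P)^T *m K - K^T *m L P + K^T *m G P *m K.
Proof.
rewrite tr_col_mx /Hmx mul_row_block mul_row_col trmx1 !mul1mx mulmx1 linearN /=.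
rewrite !(mulmxDr, mulmxDl, mulmxN, mulNmx).
by apply/matrixP => i j; rewrite !mxE; ring.
Qed.

(** The residual is the compression of H(P) to the graph of the feedback u = -Kx, and the graph map
    [col_mx 1%:M (- K)] is injective. *)
Lemma posdef_Hmx_residual K P : symmetric_mx P -> posdef_mx (Hmx A B C D Q W P) ->
  posdef_mx (residual K P).
Proof.
move=> sP pH; rewrite residual_expand // -Hmx_residual.
apply: psd_posdef; first exact/psd_congr/posdef_psd.
move=> v v0; have : qform (Hmx A B C D Q W P) (col_mx 1%:M (- K) *m v) = 0.
  by rewrite -qform_congr /qform /bform -mulmxA v0 mulmx0 mxE.
move=> /(psd_null (posdef_psd pH))/(posdef_inj pH).
by rewrite mul_col_mx mul1mx -col_mx0 => /eq_col_mx[].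
Qed.

Lemma gainP P : posdef_mx (G P) -> G P *m gain B C D W P = L P.
Proof. by move=> /posdef_unitmx uG; rewrite /gain mulmxA mulmxV // mul1mx. Qed.

(** The difference of residuals is the adjoint Lyapunov operator at [P - P'], and inverting it
    reverses the order. *)
Lemma residual_le K P P' : stable K -> symmetric_mx P -> symmetric_mx P' ->
  loewner_le (residual K P) (residual K P') -> loewner_le P' P.
Proof.
move=> st sP sP' le.
apply: (lyap_stable_psd st); first by rewrite /symmetric_mx linearB /= sP sP'.
by rewrite -residualB opprB.
Qed.

Section Step.
Variables (Pt : 'M[R]_n) (sPt : symmetric_mx Pt).
Hypotheses (pG : posdef_mx (G Pt)) (pH : posdef_mx (Hmx A B C D Q W Pt)).

(** The positive definite residual of [Pt] makes the adjoint operator strictly negative at [P - Pt],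
    which thereby becomes the certificate. *)
Lemma residual_le_stable K P : possemidef_mx (P - Pt) -> symmetric_mx P ->
  loewner_le (residual K P) 0 -> posdef_mx (P - Pt) /\ stable K.
Proof.
move=> pP sP le.
have pL : posdef_mx (- lyap_adj (A - B *m K) (C - D *m K) (P - Pt)).
  rewrite -residualB opprB.
  by rewrite -[- residual K P]add0r; apply: posdefD => //; exact: posdef_Hmx_residual.
have {}pP := psd_lyap_posdef pP pL.
by split=> //; exists (P - Pt).
Qed.

Lemma residual0_ge K P : stable K -> symmetric_mx P -> residual K P = 0 ->
  posdef_mx (P - Pt).
Proof.
move=> st sP r0; apply: (residual_le_stable (K := K) _ sP _).1.
  apply: (residual_le st) => //; rewrite r0 /loewner_le subr0.
  exact/posdef_psd/posdef_Hmx_residual.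
by rewrite r0 /loewner_le subr0; exact: psd0.
Qed.

Lemma posdef_Gmx P : possemidef_mx (P - Pt) -> posdef_mx (G P).
Proof.
move=> pP; have -> : G P = G Pt + D^T *m (P - Pt) *m D by rewrite -GmxB addrC subrK.
by apply: posdefD => //; exact: psd_congr.
Qed.

Lemma residual_gain_le K P : possemidef_mx (P - Pt) -> symmetric_mx P ->
  loewner_le (residual (gain B C D W P) P) (residual K P).
Proof.
move=> pP sP; have pGP := posdef_Gmx pP.
rewrite (residual_gain K sP (gainP pGP)) /loewner_le addrC addKr.
exact/psd_congr/posdef_psd.
Qed.

(** The new gain minimizes the residual of [P], so that residual is at most 0 and [P - Pt] certifies
    the new gain. *)
Lemma gain_stable K P : stable K -> symmetric_mx P -> residual K P = 0 ->
  stable (gain B C D W P).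
Proof.
move=> st sP r0; have pP := posdef_psd (residual0_ge st sP r0).
apply: (residual_le_stable pP sP _).2.
by rewrite -r0; exact: residual_gain_le.
Qed.

Lemma residual_surj K : symmetric_mx Q -> stable K ->
  exists2 P, symmetric_mx P & residual K P = 0.
Proof.
move=> sQ st.
have [|||P sP LP] := @lyap_adj_surj R n _ (A - B *m K) (C - D *m K) _ (- (Q + K^T *m W *m K)).
- by rewrite pnatr_eq0.
- apply: (lyap_adj_inj_lyap (F := R)); first by rewrite pnatr_eq0.
  move=> P sP LP.
  (* A kernel element is an eigenvector for 0, taken here as both parts of the pair. *)
  have [] // := @lyap_stable_eigen R n _ _ 0 0 P P st (lexx 0) sP sP.
    by rewrite LP !scale0r subr0.
  by rewrite LP !scale0r addr0.
- by rewrite linearN linearD /= sQ !trmx_mul trmxK sW mulmxA.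
by exists P => //; rewrite /residual -addrA; apply/eqP; rewrite addr_eq0; apply/eqP.
Qed.

Section Iterates.
Variables (Ps : 'M[R]_n) (sPs : symmetric_mx Ps) (pGs : posdef_mx (G Ps)).
Hypotheses (sare : solves_sare A B C D Q W Ps) (stPs : stable (gain B C D W Ps)).

Lemma residual_sare : residual (gain B C D W Ps) Ps = 0.
Proof.
rewrite residual_expand // -[_ *m G Ps *m _]mulmxA gainP // subrK -[RHS]sare.
by congr (_ - _); rewrite /gain mulmxA.
Qed.

(** Completing the square at the gain of [Ps], where its residual vanishes, shows that the residual
    of [Ps] is nonnegative at every [K]. *)
Lemma residual_sol_ge K P : stable K -> symmetric_mx P -> residual K P = 0 ->
  loewner_le Ps P.
Proof.
move=> st sP r0; apply: (residual_le st) => //.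
rewrite r0 /loewner_le subr0 (residual_gain K sPs (gainP pGs)) residual_sare add0r.
exact/psd_congr/posdef_psd.
Qed.

Variables (P : nat -> 'M[R]_n) (K : nat -> 'M[R]_(m, n)).
Hypotheses (stK0 : stable (K 0)) (sP : forall k, symmetric_mx (P k)).
Hypotheses (rP : forall k, residual (K k) (P k) = 0).
Hypothesis KS : forall k, K k.+1 = gain B C D W (P k).

Lemma iterate_stable k : stable (K k).
Proof. by elim: k => // k IH; rewrite KS; exact: gain_stable IH (sP k) (rP k). Qed.

Lemma iterate_psd k : possemidef_mx (P k - Pt).
Proof. exact/posdef_psd/(residual0_ge (iterate_stable k) (sP k) (rP k)). Qed.

Lemma iterate_ge k : loewner_le Ps (P k).
Proof. exact: residual_sol_ge (iterate_stable k) (sP k) (rP k). Qed.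

Lemma iterate_nonincreasing k : loewner_le (P k.+1) (P k).
Proof.
apply: (residual_le (iterate_stable k.+1)) => //.
rewrite (rP k.+1) KS -(rP k); exact: residual_gain_le (iterate_psd k) (sP k).
Qed.

Lemma iterate_Gmx_posdef k : posdef_mx (G (P k)).
Proof. exact/posdef_Gmx/iterate_psd. Qed.

Lemma mx_cvg_Gmx N : mx_cvg P N -> mx_cvg (fun k => G (P k)) (G N).
Proof.
move=> PN; apply: mx_cvgD; first exact: mx_cvg_cst.
by apply: mx_cvgM; [apply: mx_cvgM => //|]; exact: mx_cvg_cst.
Qed.

Lemma mx_cvg_gain N : posdef_mx (G N) -> mx_cvg P N ->
  mx_cvg K (gain B C D W N).
Proof.
move=> pGN PN; apply/mx_cvg_shiftS.
have -> : (fun k => K k.+1) = (fun k => gain B C D W (P k)) by apply/funext.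
apply: mx_cvgM.
  apply: mx_cvgV; [|exact: posdef_unitmx|exact: mx_cvg_Gmx].
  by move=> k; exact/posdef_unitmx/iterate_Gmx_posdef.
apply: mx_cvgD; first by apply: mx_cvgM => //; exact: mx_cvg_cst.
by apply: mx_cvgM; [apply: mx_cvgM => //|]; exact: mx_cvg_cst.
Qed.

(* The limit N satisfies residual (gain N) N = 0; comparing residuals at the
   stabilizing gain of Ps gives N <= Ps. *)
Lemma iterate_cvg : mx_cvg P Ps.
Proof.
have [N PN] := mx_nonincreasing_cvg iterate_ge iterate_nonincreasing sP.
have PsN : loewner_le Ps N.
  apply: (psd_closed iterate_ge); apply: mx_cvgD => //; exact: mx_cvg_cst.
have sN : symmetric_mx N.
  apply: (mx_cvg_unique (mx_cvg_tr PN)).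
  by have -> : (fun k => (P k)^T) = P by apply/funext => k; exact: sP.
have pNt : possemidef_mx (N - Pt).
  by apply: (psd_closed iterate_psd); apply: mx_cvgD => //; exact: mx_cvg_cst.
have pGN := posdef_Gmx pNt.
have KN := mx_cvg_gain pGN PN.
have rN : residual (gain B C D W N) N = 0.
  have cst0 : mx_cvg (fun k => residual (K k) (P k)) 0.
    by under eq_fun do rewrite rP; exact: mx_cvg_cst.
  apply: mx_cvg_unique cst0.
  have cA : mx_cvg (fun k => A - B *m K k) (A - B *m gain B C D W N).
    apply: mx_cvgD; first exact: mx_cvg_cst.
    by apply: mx_cvgN; apply: mx_cvgM => //; exact: mx_cvg_cst.
  have cC : mx_cvg (fun k => C - D *m K k) (C - D *m gain B C D W N).
    apply: mx_cvgD; first exact: mx_cvg_cst.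
    by apply: mx_cvgN; apply: mx_cvgM => //; exact: mx_cvg_cst.
  apply: mx_cvgD; last first.
    by apply: mx_cvgM => //; apply: mx_cvgM; [exact: mx_cvg_tr|exact: mx_cvg_cst].
  apply: mx_cvgD; last exact: mx_cvg_cst.
  apply: mx_cvgD; last first.
    by apply: mx_cvgM => //; apply: mx_cvgM => //; exact: mx_cvg_tr.
  by apply: mx_cvgD; apply: mx_cvgM => //; exact: mx_cvg_tr.
suff NPs : loewner_le N Ps by rewrite (psd_antisym PsN NPs).
apply: (residual_le stPs) => //.
rewrite residual_sare /loewner_le subr0.
rewrite (residual_gain _ sN (gainP pGN)) rN add0r.
exact/psd_congr/posdef_psd.
Qed.

End Iterates.

End Step.

End PolicyIteration.

Theorem theorem1 (R : realType) (n m : nat)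
    (A : 'M[R]_n) (B : 'M[R]_(n, m)) (C : 'M[R]_n) (D : 'M[R]_(n, m))
    (Q : 'M[R]_n) (W : 'M[R]_m)
    (hQ : symmetric_mx Q) (hW : symmetric_mx W)
    (hms : ms_stabilizing A B C D !=set0)
    (hP : exists Pt : 'M[R]_n,
       [/\ symmetric_mx Pt, posdef_mx (Gmx D W Pt)
         & posdef_mx (Hmx A B C D Q W Pt)])
    (Pstar : 'M[R]_n) (hPstar : stabilizing_solution A B C D Q W Pstar)
    (K0 : 'M[R]_(m, n)) (hK0 : K0 \in ms_stabilizing A B C D) :
  (exists (P : nat -> 'M[R]_n) (K : nat -> 'M[R]_(m, n)),
     policy_iteration A B C D Q W K0 P K) /\
  (forall (P : nat -> 'M[R]_n) (K : nat -> 'M[R]_(m, n)),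
     policy_iteration A B C D Q W K0 P K ->
     [/\ forall k : nat,
           [/\ loewner_le Pstar (P k),
               loewner_le (Gmx D W Pstar) (Gmx D W (P k)),
               posdef_mx (Gmx D W Pstar)
             & Gmx D W (P k) \in unitmx],
         forall k : nat, K k \in ms_stabilizing A B C D,
         forall k : nat,
           loewner_le Pstar (P k.+1) /\ loewner_le (P k.+1) (P k)
       & (P k @[k --> \oo] --> Pstar) /\
         (K k @[k --> \oo] --> gain B C D W Pstar)]).
Proof.
(* For n = 0 the spectrum is empty and sup set0 = 0, so no gain is stabilizing. *)
have n_gt0 : (0 < n)%N.
  case: hms => K; rewrite /ms_stabilizing /= lt0n; apply: contraPneq => n0.
  rewrite /spectral_abscissa.
  have -> : sym_spectrum (lyap_op A B C D K) = set0.
    apply/seteqP; split=> // l [Z [_ /eqP Z0 _]]; apply: Z0.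
    by apply/matrixP => i; have : (i < 0)%N by rewrite -n0 ltn_ord.
  by rewrite image_set0 sup0 ltxx.
have msP K : K \in ms_stabilizing A B C D
    <-> lyap_stable (A - B *m K) (C - D *m K).
  by rewrite inE; exact: spectral_abscissa_lyap.
have [Pt [sPt pG pH]] := hP.
case: hPstar => sPs sare pGs /msP stPs.
split.
  (* Putting stability inside the existential makes the solution a total function of [K], which can
     be iterated; its value at unstable gains is a dummy. *)
  have solve K : exists P, lyap_stable (A - B *m K) (C - D *m K) ->
      symmetric_mx P /\ residual A B C D Q W K P = 0.
    have [st|nst] := pselect (lyap_stable (A - B *m K) (C - D *m K)).
      by have [P sP rP] := residual_surj hW hQ st; exists P.
    by exists 0.
  have [sol solP] := choice solve.
  pose K k := iter k (fun K => gain B C D W (sol K)) K0.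
  exists (fun k => sol (K k)), K; split=> // k.
  have st : lyap_stable (A - B *m K k) (C - D *m K k).
    elim: k => [|k IH]; first exact/msP.
    have [sP rP] := solP _ IH.
    exact: (gain_stable hW sPt pG pH IH sP rP).
  by have [sP rP] := solP _ st; split.
move=> P K [K0E PK].
have sP k : symmetric_mx (P k) by case: (PK k).
have rP k : residual A B C D Q W (K k) (P k) = 0 by case: (PK k).
have KS k : K k.+1 = gain B C D W (P k) by case: (PK k).
have stK0 : lyap_stable (A - B *m K 0%N) (C - D *m K 0%N) by rewrite K0E; exact/msP.
have ge := iterate_ge hW sPt pG pH sPs pGs sare stK0 sP rP KS.
have cvgP := iterate_cvg hW sPt pG pH sPs pGs sare stPs stK0 sP rP KS.
split.
- move=> k; split=> //; first by rewrite /loewner_le GmxB; exact/psd_congr/ge.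
  exact/posdef_unitmx/(iterate_Gmx_posdef hW sPt pG pH stK0 sP rP KS).
- move=> k; apply/msP.
  exact: (iterate_stable hW sPt pG pH stK0 sP rP KS).
- move=> k; split=> //.
  exact: (iterate_nonincreasing hW sPt pG pH stK0 sP rP KS).
- split; first exact: mx_cvg_cvg.
  apply: mx_cvg_cvg.
  exact: (mx_cvg_gain hW sPt pG pH stK0 sP rP KS pGs cvgP).
Qed.
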